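(* Let $\lambda_1,\lambda_2$ be positive integers with $1<\lambda_1/\lambda_2<3+2\sqrt2$ and $\lambda_1-\lambda_2\ge 702$. Put $r=\lambda_1/\lambda_2$, $\rho=1/\sqrt r$, $\gamma_1=\arccos\frac{3\lambda_1-\lambda_2}{2\sqrt2\lambda_1}$, $\gamma_2=-\arccos\frac{\lambda_1-3\lambda_2}{2\sqrt2\lambda_2}$, and $$I(\lambda_2)=\int_{-\pi}^{\pi}(1+\rho e^{i\theta})^{\lambda_1}(1-\rho e^{i\theta})^{\lambda_2}(\rho e^{i\theta})^{-\lambda_2}\frac{d\theta}{2\pi}.$$ Let $E=\left\vert \frac{\sqrt{\pi\lambda_2}}{2^{(\lambda_1+\lambda_2+1)/2}}I(\lambda_2)-\cos(\lambda_1\gamma_1+\lambda_2\gamma_2)\right\vert$. Then $E\le 0.0165$ whenever $\lambda_1-\lambda_2\le\sqrt{8\pi\lambda_2}$, and $$\sqrt{\lambda_2}\,E\le\begin{cases}1.05882&\text{if }\log\lambda_2\le\lambda_1-\lambda_2\le\sqrt{\pi\lambda_2};\\ 1.30775&\text{if }\sqrt{\pi\lambda_2}\le\lambda_1-\lambda_2\le\sqrt{2\pi\lambda_2};\\ 1.50929&\text{if }\sqrt{2\pi\lambda_2}\le\lambda_1-\lambda_2\le\sqrt{3\pi\lambda_2};\\ 1.68876&\text{if }\sqrt{3\pi\lambda_2}\le\lambda_1-\lambda_2\le\sqrt{4\pi\lambda_2};\\ 1.85482&\text{if }\sqrt{4\pi\lambda_2}\le\lambda_1-\lambda_2\le\sqrt{5\pi\lambda_2};\\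 2.01189&\text{if }\sqrt{5\pi\lambda_2}\le\lambda_1-\lambda_2\le\sqrt{6\pi\lambda_2};\\ 2.1626&\text{if }\sqrt{6\pi\lambda_2}\le\lambda_1-\lambda_2\le\sqrt{7\pi\lambda_2};\\ 2.30865&\text{if }\sqrt{7\pi\lambda_2}\le\lambda_1-\lambda_2\le\sqrt{8\pi\lambda_2}.\end{cases}$$
   Context: $\arccos$ takes its principal value in $[0,\pi]$. *)

(* Defs.v *)
From Stdlib Require Import Reals.
From Coquelicot Require Import Coquelicot.

Open Scope R_scope.

Definition Cexpi (t : R) : C := (cos t, sin t).

Definition rho (l1 l2 : nat) : R := 1 / sqrt (INR l1 / INR l2).

Definition gamma1 (l1 l2 : nat) : R :=
  acos ((3 * INR l1 - INR l2) / (2 * sqrt 2 * INR l1)).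

Definition gamma2 (l1 l2 : nat) : R :=
  - acos ((INR l1 - 3 * INR l2) / (2 * sqrt 2 * INR l2)).

(* The negative power [z ^ (- l2)] is written [/ z ^ l2]; the base
   [rho * exp (i t)] never vanishes when [l1] and [l2] are positive. *)
Definition integrand (l1 l2 : nat) (t : R) : C :=
  let z := (RtoC (rho l1 l2) * Cexpi t)%C in
  ((1 + z) ^ l1 * (1 - z) ^ l2 * / z ^ l2 * RtoC (/ (2 * PI)))%C.

Definition I_int (l1 l2 : nat) : C :=
  RInt (V := C_R_CompleteNormedModule) (integrand l1 l2) (- PI) PI.

(* [I_int] is complex-valued by construction, so the outer absolute value
   is the complex modulus. *)
Definition E_err (l1 l2 : nat) : R :=
  Cmod (RtoC (sqrt (PI * INR l2) / Rpower 2 ((INR l1 + INR l2 + 1) / 2))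
          * I_int l1 l2
        - RtoC (cos (INR l1 * gamma1 l1 l2 + INR l2 * gamma2 l1 l2)))%C.

(* Main.v *)
Require Import Defs.
From Stdlib Require Import Reals Lra Lia.
From Coquelicot Require Import Coquelicot.
Open Scope R_scope.

(* Laplace's method on the circle [|z| = rho], which passes through both saddle points
   [z0 = rho exp (i th0)] and [conj z0].  At [z0] one has [1 + z0 = sqrt 2 exp (i gamma1)]
   and [(1 - z0) / z0 = sqrt 2 exp (i gamma2)], so the cosine in the theorem is the
   normalised value of the integrand there.  Put [d = l1 / l2 - 1], [n = l2] and
   [e = cos th0 = d / (2 sqrt (1 + d))].  Along the circle the logarithmic derivative of
   the integrand in the angle [th] is [p + i q] with
     [p = n (1 + d / 2) (cos th - e) sin th / (sin th ^ 2 + e ^ 2)],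
     [q = - n (d / 2) (cos th - e) cos th / (sin th ^ 2 + e ^ 2)].
   With [s = th - th0] this is [- n tan s], the logarithmic derivative of [cos s ^ n], up to
   an error at most [3/4 n d |s|] for [|s| <= 1/5].  Hence the normalised integrand differs
   from its value at the saddle times [cos s ^ n] by a multiple of [n d s ^ 2 cos s ^ n], and
   outside that window it is exponentially small.  Comparing with powers of the cosine rather
   than with a Gaussian lets Wallis' recurrence evaluate both the main term and the second
   moment.  The outcome, [E <= 0.44 (l1 - l2) / l2], implies all nine estimates. *)

(** * Monotonicity and integrability from derivatives *)

Lemma nonincreasing_of_derive (f df : R -> R) (a b : R) :
  a <= b ->
  (forall x, a <= x <= b -> is_derive f x (df x)) ->
  (forall x, a <= x <= b -> df x <= 0) ->
  f b <= f a.
Proof.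
intros hab hd hneg.
destruct (MVT_gen f a b df) as [c [hc hfc]].
- intros x hx; apply hd; rewrite Rmin_left, Rmax_right in hx; lra.
- intros x hx; apply continuity_pt_filterlim, (ex_derive_continuous f).
  exists (df x); apply hd; rewrite Rmin_left, Rmax_right in hx; lra.
- rewrite Rmin_left, Rmax_right in hc by lra.
  specialize (hneg c hc); nra.
Qed.

Lemma ex_RInt_of_derive (f df : R -> R) (a b : R) :
  a <= b -> (forall x, a <= x <= b -> is_derive f x (df x)) -> ex_RInt f a b.
Proof.
intros hab hd; apply (ex_RInt_continuous (V := R_CompleteNormedModule)).
intros x hx; rewrite Rmin_left, Rmax_right in hx by lra.
apply (ex_derive_continuous f); exists (df x); now apply hd.
Qed.

Lemma ex_RInt_cos_pow (n : nat) (a b : R) : ex_RInt (fun t => cos t ^ n) a b.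
Proof.
apply (ex_RInt_continuous (V := R_CompleteNormedModule)); intros x _.
apply (ex_derive_continuous (fun t : R => cos t ^ n)); auto_derive; trivial.
Qed.

(** * Wallis integrals *)

Definition wallis (n : nat) : R := RInt (fun t => cos t ^ n) 0 (PI / 2).

Lemma wallis_0 : wallis 0 = PI / 2.
Proof.
unfold wallis; simpl; rewrite RInt_const; unfold scal; simpl; unfold mult; simpl; lra.
Qed.

Lemma wallis_1 : wallis 1 = 1.
Proof.
unfold wallis; rewrite (RInt_ext _ cos) by (intros; simpl; ring).
assert (H : is_RInt cos 0 (PI / 2) (minus (sin (PI / 2)) (sin 0))).
{ apply (is_RInt_derive (V := R_CompleteNormedModule) sin cos).
  - intros x _; auto_derive; trivial; ring.
  - intros x _; apply (ex_derive_continuous cos); auto_derive; trivial. }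
apply (is_RInt_unique (V := R_CompleteNormedModule)) in H; simpl in H |- *; rewrite H.
unfold minus, plus, opp; simpl; rewrite sin_PI2, sin_0; ring.
Qed.

(** The weighted difference of the two integrands is the derivative of [sin t * cos t ^ S n], which
    vanishes at both ends of the interval. *)
Lemma wallis_rec (n : nat) :
  (INR n + 2) * wallis (S (S n)) = (INR n + 1) * wallis n.
Proof.
assert (H : is_RInt (fun t => (INR n + 2) * cos t ^ S (S n) - (INR n + 1) * cos t ^ n)
              0 (PI / 2)
              (minus (sin (PI / 2) * cos (PI / 2) ^ S n) (sin 0 * cos 0 ^ S n))).
{ apply (is_RInt_derive (V := R_CompleteNormedModule) (fun t => sin t * cos t ^ S n)).
  - intros x _; auto_derive; trivial.
    pose proof (sin2_cos2 x) as h; unfold Rsqr in h.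
    (* The [match] is [INR (S n)] unfolded. *)
    replace (match n with 0%nat => 1 | S _ => INR n + 1 end) with (INR n + 1)
      by (destruct n; simpl; ring).
    simpl pow; unfold Init.Nat.pred.
    replace (1 * cos x * (cos x * cos x ^ n) + sin x * (1 * - sin x * ((INR n + 1) * cos x ^ n)))
      with (cos x ^ n * (cos x * cos x - (INR n + 1) * (sin x * sin x))) by ring.
    replace (sin x * sin x) with (1 - cos x * cos x) by lra; ring.
  - intros x _; apply (ex_derive_continuous
      (fun t : R => (INR n + 2) * cos t ^ S (S n) - (INR n + 1) * cos t ^ n)).
    auto_derive; trivial. }
assert (H2 : is_RInt (fun t => (INR n + 2) * cos t ^ S (S n) - (INR n + 1) * cos t ^ n)
              0 (PI / 2) ((INR n + 2) * wallis (S (S n)) - (INR n + 1) * wallis n)).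
{ apply (is_RInt_minus (V := R_NormedModule)); apply (is_RInt_scal (V := R_NormedModule));
    apply (RInt_correct (V := R_CompleteNormedModule)), ex_RInt_cos_pow. }
apply (is_RInt_unique (V := R_CompleteNormedModule)) in H; apply (is_RInt_unique (V := R_CompleteNormedModule)) in H2.
rewrite H in H2; unfold minus, plus, opp in H2; simpl in H2.
rewrite cos_PI2, sin_0 in H2; simpl; lra.
Qed.

(** The recurrence makes the left side independent of [n]; its value is read off at [n = 0]. *)
Lemma wallis_prod (n : nat) : (INR n + 1) * (wallis n * wallis (S n)) = PI / 2.
Proof.
induction n as [|n IH].
- rewrite wallis_0, wallis_1; simpl; lra.
- rewrite <- IH, S_INR; pose proof (wallis_rec n) as h.
  replace ((INR n + 1 + 1) * (wallis (S n) * wallis (S (S n))))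
    with (wallis (S n) * ((INR n + 2) * wallis (S (S n)))) by ring.
  rewrite h; ring.
Qed.

Lemma wallis_decr (n : nat) : wallis (S n) <= wallis n.
Proof.
apply RInt_le; try apply ex_RInt_cos_pow.
- pose proof PI_RGT_0; lra.
- intros x hx; assert (0 <= cos x) by (apply cos_ge_0; lra).
  assert (cos x <= 1) by apply COS_bound.
  assert (0 <= cos x ^ n) by now apply pow_le.
  simpl; nra.
Qed.

Lemma wallis_nonneg (n : nat) : 0 <= wallis n.
Proof.
apply RInt_ge_0; [pose proof PI_RGT_0; lra | apply ex_RInt_cos_pow |].
intros x hx; apply pow_le, cos_ge_0; lra.
Qed.

(** Monotonicity turns the exact product [wallis_prod] into bounds for the square, here through the
    preceding index and in the next lemma through the following one. Together they replace
    Stirling's formula: [wallis n] behaves like [sqrt (PI / (2 * INR n))] with an explicit error. *)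
Lemma wallis_sqr_le (n : nat) : INR n * wallis n ^ 2 <= PI / 2.
Proof.
destruct n as [|n].
- simpl; pose proof PI_RGT_0; lra.
- rewrite <- (wallis_prod n), S_INR.
  pose proof (wallis_decr n); pose proof (wallis_nonneg (S n)); pose proof (pos_INR n).
  apply Rmult_le_compat_l; nra.
Qed.

Lemma wallis_sqr_ge (n : nat) : PI / 2 <= (INR n + 1) * wallis n ^ 2.
Proof.
rewrite <- (wallis_prod n).
pose proof (wallis_decr n); pose proof (wallis_nonneg n); pose proof (pos_INR n).
apply Rmult_le_compat_l; nra.
Qed.

(** Writing [sin t ^ 2] as [1 - cos t ^ 2] gives [wallis n - wallis (S (S n))], which the recurrence
    evaluates. This is the second moment, with [sin t ^ 2] in place of [t ^ 2] to keep it exact. *)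
Lemma RInt_cos_pow_sin_sqr (n : nat) :
  is_RInt (fun t => cos t ^ n * sin t ^ 2) 0 (PI / 2) (wallis n / (INR n + 2)).
Proof.
replace (wallis n / (INR n + 2)) with (wallis n - wallis (S (S n))).
2: { pose proof (pos_INR n); pose proof (wallis_rec n) as h.
     apply (Rmult_eq_reg_l (INR n + 2)); [|lra].
     rewrite Rmult_minus_distr_l, h; field; lra. }
apply (is_RInt_ext (fun t => cos t ^ n - cos t ^ S (S n))).
- intros x _; pose proof (sin2_cos2 x) as h; unfold Rsqr in h.
  simpl; replace (sin x * (sin x * 1)) with (1 - cos x * cos x) by lra; ring.
- apply (is_RInt_minus (V := R_NormedModule));
    apply (RInt_correct (V := R_CompleteNormedModule)), ex_RInt_cos_pow.
Qed.

(** * Laplace estimate on one side of the saddle *)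

Lemma taylor_bounds (s : R) : 0 <= s <= 1/5 ->
  s - s ^ 3 / 6 <= sin s <= s /\ 1 - s ^ 2 / 2 <= cos s <= 1 - s ^ 2 / 2 + s ^ 4 / 24.
Proof.
intros hs; pose proof PI_RGT_0; pose proof PI2_1.
destruct (sin_bound s 0) as [h1 _]; [lra|lra|].
destruct (cos_bound s 0) as [h3 h4]; [lra|lra|].
unfold sin_approx, cos_approx, sum_f_R0, sin_term, cos_term in *; simpl in *.
assert (sin s <= s).
{ destruct (Req_dec s 0) as [-> | hs0]; [rewrite sin_0; lra|].
  apply Rlt_le, sin_lt_x; lra. }
repeat split; lra.
Qed.

Lemma cos_small_pos s : 0 <= s <= 1/5 -> 0 < cos s.
Proof. intros hs; destruct (taylor_bounds s hs) as [_ [h _]]; nra. Qed.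

(** The angular rate [k] only rotates [u + i v], so it cancels from the squared modulus. *)
Lemma derive_norm_sqr (u v g k : R -> R) (t : R) :
  is_derive u t (g t * u t - k t * v t) -> is_derive v t (g t * v t + k t * u t) ->
  is_derive (fun t => u t ^ 2 + v t ^ 2) t (2 * g t * (u t ^ 2 + v t ^ 2)).
Proof.
intros hu hv; auto_derive.
- repeat split; eexists; [exact hu | exact hv].
- replace (Derive (fun x0 => u x0) t) with (g t * u t - k t * v t)
    by (symmetry; now apply is_derive_unique).
  replace (Derive (fun x0 => v x0) t) with (g t * v t + k t * u t)
    by (symmetry; now apply is_derive_unique).
  ring.
Qed.

Lemma Rabs_le_1_of_sqr (a c : R) : a ^ 2 + c ^ 2 <= 1 -> Rabs a <= 1.
Proof. intros h; apply Rabs_le; nra. Qed.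

(* [X + i Y] solves the linear equation with logarithmic derivative [p + i q], and
   [q] and the gap between [p] and that of [cos ^ n] are linear in [s].  The
   quotient by [cos ^ n] then has modulus at most [1] near [0] and moves by at most
   [K s ^ 2 / 2]; away from [0] the modulus of [X + i Y] only decreases. *)
Section OneSided.

Variables (n : nat) (X Y p q : R -> R) (b K : R).
Hypothesis (hb : 1/5 <= b) (hK : 0 <= K).
Hypothesis hX : forall s, 0 <= s <= b -> is_derive X s (p s * X s - q s * Y s).
Hypothesis hY : forall s, 0 <= s <= b -> is_derive Y s (p s * Y s + q s * X s).
Hypothesis h0 : X 0 ^ 2 + Y 0 ^ 2 = 1.
Hypothesis hp : forall s, 0 <= s <= b -> p s <= 0.
Hypothesis hpt : forall s, 0 <= s <= 1/5 -> p s + INR n * (sin s / cos s) <= 0.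
Hypothesis hpq : forall s, 0 <= s <= 1/5 ->
  Rabs (p s + INR n * (sin s / cos s)) + Rabs (q s) <= K * s.

Let x (s : R) := X s / cos s ^ n.
Let y (s : R) := Y s / cos s ^ n.
Let f (s : R) := p s + INR n * (sin s / cos s).

(** Dividing by [cos s ^ n], whose logarithmic derivative is [- n tan s], adds [n tan s] to the
    logarithmic derivative. *)
Lemma derive_div_cos_pow (g : R -> R) (dg s : R) : 0 <= s <= 1/5 ->
  is_derive g s dg ->
  is_derive (fun s => g s / cos s ^ n) s
    ((dg + INR n * (sin s / cos s) * g s) / cos s ^ n).
Proof.
intros hs hg; pose proof (cos_small_pos s hs) as hc.
assert (hcn : cos s ^ n <> 0) by (apply pow_nonzero; lra).
auto_derive.
- repeat split; [exists dg; exact hg | assumption].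
- replace (Derive (fun x0 => g x0) s) with dg by (symmetry; now apply is_derive_unique).
  (* The exponent [pred n] in the derivative makes [n = 0] a separate case. *)
  destruct n as [|m]; [simpl; field; lra|].
  assert (cos s ^ m <> 0) by (apply pow_nonzero; lra).
  rewrite S_INR; simpl; field; lra.
Qed.

Lemma ratio_derive_x s : 0 <= s <= 1/5 -> is_derive x s (f s * x s - q s * y s).
Proof.
intros hs; unfold x, y, f.
replace (_ - _) with ((p s * X s - q s * Y s + INR n * (sin s / cos s) * X s) / cos s ^ n)
  by (unfold Rdiv; ring).
apply derive_div_cos_pow; trivial; apply hX; lra.
Qed.

Lemma ratio_derive_y s : 0 <= s <= 1/5 -> is_derive y s (f s * y s + q s * x s).
Proof.
intros hs; unfold x, y, f.
replace (_ + _) with ((p s * Y s + q s * X s + INR n * (sin s / cos s) * Y s) / cos s ^ n)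
  by (unfold Rdiv; ring).
apply derive_div_cos_pow; trivial; apply hY; lra.
Qed.

(** [hpt] makes the real part [f] of the ratio's logarithmic derivative nonpositive, so the modulus
    never exceeds its initial value [1]. *)
Lemma ratio_norm_le s : 0 <= s <= 1/5 -> x s ^ 2 + y s ^ 2 <= 1.
Proof.
intros hs; replace 1 with (x 0 ^ 2 + y 0 ^ 2).
2: { unfold x, y; rewrite cos_0, pow1, !Rdiv_1_r; exact h0. }
apply (nonincreasing_of_derive (fun t => x t ^ 2 + y t ^ 2)
         (fun t => 2 * f t * (x t ^ 2 + y t ^ 2))); [lra| |].
- intros t ht; apply derive_norm_sqr with (k := q);
    [apply ratio_derive_x | apply ratio_derive_y]; lra.
- intros t ht; assert (f t <= 0) by (apply hpt; lra).
  pose proof (pow2_ge_0 (x t)); pose proof (pow2_ge_0 (y t)); nra.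
Qed.

(** As [x] and [y] are at most [1] in absolute value, [hpq] bounds the speed of [x] by [K * t]. This
    is integrated by checking that [x - K / 2 * t ^ 2] and [- x - K / 2 * t ^ 2] do not increase. *)
Lemma ratio_dist s : 0 <= s <= 1/5 -> Rabs (x s - x 0) <= K / 2 * s ^ 2.
Proof.
intros hs.
assert (hbound : forall t, 0 <= t <= 1/5 -> Rabs (f t * x t - q t * y t) <= K * t).
{ intros t ht; pose proof (ratio_norm_le t ht) as hn.
  assert (hx1 : Rabs (x t) <= 1) by (eapply Rabs_le_1_of_sqr; exact hn).
  assert (hy1 : Rabs (y t) <= 1)
    by (apply (Rabs_le_1_of_sqr (y t) (x t)); lra).
  eapply Rle_trans; [|apply hpq; exact ht].
  unfold Rminus; eapply Rle_trans; [apply Rabs_triang|].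
  rewrite Rabs_Ropp, !Rabs_mult; fold (f t).
  pose proof (Rabs_pos (f t)); pose proof (Rabs_pos (q t)); nra. }
apply Rabs_le; split.
- assert (h : - x s - K / 2 * s ^ 2 <= - x 0 - K / 2 * 0 ^ 2).
  { apply (nonincreasing_of_derive (fun t => - x t - K / 2 * t ^ 2)
             (fun t => - (f t * x t - q t * y t) - K * t)); [lra| |].
    - intros t ht; assert (ht' : 0 <= t <= 1/5) by lra; pose proof (ratio_derive_x t ht') as hd.
      auto_derive; [eexists; exact hd|].
      replace (Derive (fun x0 => x x0) t) with (f t * x t - q t * y t)
        by (symmetry; now apply is_derive_unique).
      field.
    - intros t ht; specialize (hbound t); apply Rabs_le_between in hbound; lra. }
  lra.
- assert (h : x s - K / 2 * s ^ 2 <= x 0 - K / 2 * 0 ^ 2).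
  { apply (nonincreasing_of_derive (fun t => x t - K / 2 * t ^ 2)
             (fun t => (f t * x t - q t * y t) - K * t)); [lra| |].
    - intros t ht; assert (ht' : 0 <= t <= 1/5) by lra; pose proof (ratio_derive_x t ht') as hd.
      auto_derive; [eexists; exact hd|].
      replace (Derive (fun x0 => x x0) t) with (f t * x t - q t * y t)
        by (symmetry; now apply is_derive_unique).
      field.
    - intros t ht; specialize (hbound t); apply Rabs_le_between in hbound; lra. }
  lra.
Qed.

Lemma near_pointwise s : 0 <= s <= 1/5 ->
  Rabs (X s - X 0 * cos s ^ n) <= 51/100 * K * (cos s ^ n * sin s ^ 2).
Proof.
intros hs; pose proof (cos_small_pos s hs) as hc.
assert (hcn : 0 < cos s ^ n) by now apply pow_lt.
replace (X s - X 0 * cos s ^ n) with ((x s - x 0) * cos s ^ n).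
2: { unfold x; rewrite cos_0, pow1; field; lra. }
rewrite Rabs_mult, (Rabs_pos_eq (cos s ^ n)) by lra.
pose proof (ratio_dist s hs).
(* On this window [sin s >= s * (1 - s ^ 2 / 6) >= 0.993 * s], and [1.02 * 0.993 ^ 2 > 1]. Trading
   [s ^ 2] for [sin s ^ 2] makes the error integrable in closed form and turns [K / 2] into
   [51/100 * K]. *)
assert (s ^ 2 <= 102/100 * sin s ^ 2).
{ destruct (taylor_bounds s hs) as [[h _] _].
  assert (s * (993/1000) <= sin s) by nra.
  assert ((s * (993/1000)) ^ 2 <= sin s ^ 2) by (apply pow_incr; nra).
  nra. }
apply Rle_trans with (K / 2 * s ^ 2 * cos s ^ n); [nra|].
replace (51/100 * K * (cos s ^ n * sin s ^ 2))
  with (K / 2 * (102/100 * sin s ^ 2) * cos s ^ n) by field.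
apply Rmult_le_compat_r; [lra|]; apply Rmult_le_compat_l; lra.
Qed.

(** Past [1/5] the sign of [p] keeps the squared modulus from growing, and at [1/5] it is at most
    the square of [cos (1/5) ^ n] by [ratio_norm_le]. *)
Lemma far_pointwise s : 1/5 <= s <= b -> Rabs (X s) <= cos (1/5) ^ n.
Proof.
intros hs.
assert (hc : 0 < cos (1/5) ^ n) by (apply pow_lt, cos_small_pos; lra).
assert (h1 : X s ^ 2 + Y s ^ 2 <= X (1/5) ^ 2 + Y (1/5) ^ 2).
{ apply (nonincreasing_of_derive (fun t => X t ^ 2 + Y t ^ 2)
         (fun t => 2 * p t * (X t ^ 2 + Y t ^ 2))); [lra| |].
  - intros t ht; apply derive_norm_sqr with (k := q); [apply hX | apply hY]; lra.
  - intros t ht; assert (p t <= 0) by (apply hp; lra).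
    pose proof (pow2_ge_0 (X t)); pose proof (pow2_ge_0 (Y t)); nra. }
assert (h2 : X (1/5) ^ 2 + Y (1/5) ^ 2 <= (cos (1/5) ^ n) ^ 2).
{ assert (hs' : 0 <= 1/5 <= 1/5) by lra.
  pose proof (ratio_norm_le _ hs') as h; unfold x, y in h.
  assert (X (1/5) ^ 2 + Y (1/5) ^ 2
    = ((X (1/5) / cos (1/5) ^ n) ^ 2 + (Y (1/5) / cos (1/5) ^ n) ^ 2) * (cos (1/5) ^ n) ^ 2)
    by (field; lra).
  pose proof (pow2_ge_0 (cos (1/5) ^ n)); nra. }
apply Rabs_le; pose proof (pow2_ge_0 (Y s)); split; nra.
Qed.

Lemma ex_RInt_X a c : 0 <= a -> a <= c -> c <= b -> ex_RInt X a c.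
Proof.
intros; apply (ex_RInt_of_derive X (fun s => p s * X s - q s * Y s)); [lra|].
intros; apply hX; lra.
Qed.

(** Both integrals are split at [1/5]. The near parts differ by at most [51/100 * K] times the
    second moment. Each far part is at most its length times [cos (1/5) ^ n], and the lengths
    [b - 1/5] and [PI / 2 - 1/5] add up to less than [b + 2]. *)
Lemma one_sided_laplace :
  Rabs (RInt X 0 b - X 0 * wallis n)
  <= 51/100 * K * (wallis n / (INR n + 2)) + (b + 2) * cos (1/5) ^ n.
Proof.
assert (hc : 0 < cos (1/5) ^ n) by (apply pow_lt, cos_small_pos; lra).
pose proof PI_RGT_0; pose proof PI_4; pose proof PI2_1.
assert (hX0 : Rabs (X 0) <= 1) by (apply (Rabs_le_1_of_sqr _ (Y 0)); lra).
assert (hsplit1 : RInt X 0 b = RInt X 0 (1/5) + RInt X (1/5) b).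
{ symmetry; apply (RInt_Chasles (V := R_CompleteNormedModule)); apply ex_RInt_X; lra. }
assert (hsplit2 : wallis n = RInt (fun t => cos t ^ n) 0 (1/5)
                             + RInt (fun t => cos t ^ n) (1/5) (PI / 2)).
{ symmetry; apply (RInt_Chasles (V := R_CompleteNormedModule)); apply ex_RInt_cos_pow. }
assert (hfarX : Rabs (RInt X (1/5) b) <= (b - 1/5) * cos (1/5) ^ n).
{ apply abs_RInt_le_const; [lra| apply ex_RInt_X; lra | apply far_pointwise]. }
assert (hfarc : Rabs (RInt (fun t => cos t ^ n) (1/5) (PI / 2))
                <= (PI / 2 - 1/5) * cos (1/5) ^ n).
{ apply abs_RInt_le_const; [lra| apply ex_RInt_cos_pow |].
  intros t ht; assert (0 <= cos t) by (apply cos_ge_0; lra).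
  rewrite Rabs_pos_eq by now apply pow_le.
  apply pow_incr; split; trivial; apply cos_decr_1; lra. }
set (e := fun t => X t - X 0 * cos t ^ n).
assert (hee : ex_RInt e 0 (1/5)).
{ apply (ex_RInt_minus (V := R_NormedModule)); [apply ex_RInt_X; lra|].
  apply (ex_RInt_scal (V := R_NormedModule)), ex_RInt_cos_pow. }
assert (he : RInt e 0 (1/5) = RInt X 0 (1/5) - X 0 * RInt (fun t => cos t ^ n) 0 (1/5)).
{ apply (is_RInt_unique (V := R_CompleteNormedModule)); apply (is_RInt_minus (V := R_NormedModule)).
  - apply (RInt_correct (V := R_CompleteNormedModule)), ex_RInt_X; lra.
  - apply (is_RInt_scal (V := R_NormedModule)).
    apply (RInt_correct (V := R_CompleteNormedModule)), ex_RInt_cos_pow. }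
set (g := fun t => cos t ^ n * sin t ^ 2).
assert (heg : forall u v, ex_RInt g u v).
{ intros u v; apply (ex_RInt_continuous (V := R_CompleteNormedModule)); intros z _.
  apply (ex_derive_continuous g); unfold g; auto_derive; trivial. }
(* [g] is nonnegative up to [PI / 2], so the window may be enlarged to the quarter period. *)
assert (hg : RInt g 0 (1/5) <= wallis n / (INR n + 2)).
{ rewrite <- (is_RInt_unique _ _ _ _ (RInt_cos_pow_sin_sqr n)); fold g.
  rewrite <- (RInt_Chasles (V := R_CompleteNormedModule) g 0 (1/5) (PI / 2)) by apply heg.
  assert (0 <= RInt g (1/5) (PI / 2)).
  { apply RInt_ge_0; [lra | apply heg |].
    intros t ht; unfold g; apply Rmult_le_pos; [apply pow_le, cos_ge_0; lra | apply pow2_ge_0]. }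
  unfold plus; simpl; lra. }
assert (hnear : Rabs (RInt e 0 (1/5)) <= 51/100 * K * RInt g 0 (1/5)).
{ eapply Rle_trans; [apply abs_RInt_le; [lra | exact hee]|].
  replace (51/100 * K * RInt g 0 (1/5)) with (RInt (fun t => 51/100 * K * g t) 0 (1/5)).
  2: { apply (RInt_scal (V := R_CompleteNormedModule)), heg. }
  apply RInt_le; [lra | | apply (ex_RInt_scal (V := R_NormedModule)), heg |].
  - now apply ex_RInt_norm in hee.
  - intros t ht; apply near_pointwise; lra. }
replace (RInt X 0 b - X 0 * wallis n)
  with (RInt e 0 (1/5) + (RInt X (1/5) b - X 0 * RInt (fun t => cos t ^ n) (1/5) (PI / 2)))
  by (rewrite he, hsplit1, hsplit2; ring).
eapply Rle_trans; [apply Rabs_triang|].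
apply Rplus_le_compat.
- eapply Rle_trans; [exact hnear|]; apply Rmult_le_compat_l; lra.
- unfold Rminus; eapply Rle_trans; [apply Rabs_triang|].
  rewrite Rabs_Ropp, Rabs_mult.
  pose proof (Rabs_pos (RInt (fun t => cos t ^ n) (1/5) (PI / 2))); nra.
Qed.

End OneSided.

(** * Comparison of the logarithmic derivative with that of a power of the cosine *)

(* [ct] and [st] are the cosine and sine of [th0 + sg * s], where [cos th0 = e],
   [sin th0 = b], [cos s = C] and [sin s = S]; the sign [sg] selects the side of the
   saddle. *)
Lemma log_derivative_bounds (N d e b S C sg : R) :
  0 <= N -> 0 < d <= 36/1000 -> 0 < e -> 4 * (1 + d) * e ^ 2 = d ^ 2 ->
  0 < b -> b ^ 2 = 1 - e ^ 2 -> S ^ 2 + C ^ 2 = 1 -> 0 <= S <= 1/5 -> 0 < C ->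
  sg = 1 \/ sg = -1 ->
  let ct := e * C - b * (sg * S) in
  let st := b * C + e * (sg * S) in
  let P := N * (1 + d / 2) * (ct - e) * st / (st ^ 2 + e ^ 2) in
  let Q := - (N * (d / 2) * (ct - e) * ct / (st ^ 2 + e ^ 2)) in
  sg * P + N * (S / C) <= 0 /\
  Rabs (sg * P + N * (S / C)) + Rabs Q <= 3 / 4 * (N * d) * S.
Proof.
intros hN hd he hed hb hbe hSC hS hC hsg ct st P Q.
(* The hypotheses say [e = d / (2 sqrt (1 + d))], and [1 / sqrt 1.036 > 0.98]. *)
assert (he1 : e <= d / 2) by nra.
assert (he2 : 98/100 * (d / 2) <= e) by nra.
assert (hb1 : 999/1000 <= b) by nra.
assert (hb2 : b <= 1) by nra.
assert (hC1 : 979/1000 <= C) by nra.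
assert (hC2 : C <= 1) by nra.
assert (hC3 : 0 <= 1 - C <= 102/1000 * S) by nra.
assert (hst : 97/100 <= st <= 102/100) by (unfold st; destruct hsg; subst sg; nra).
assert (hden : 94/100 <= st ^ 2 + e ^ 2) by nra.
set (den := st ^ 2 + e ^ 2) in *.
(* Over the common denominator [den * C] the sum has numerator [- N * B]. The first term of [B] is
   the main one, of order [S]; the second carries the factor [1 - C], of second order in [S]. *)
set (B := S * (d / 2 * b * st * C - e ^ 2) - sg * (e * st * (1 - C) * (1 - d / 2 * C))).
assert (hP : sg * P + N * (S / C) = - (N * (B / (den * C)))).
{ apply (Rmult_eq_reg_r (den * C)); [|nra].
  transitivity (sg * (N * (1 + d / 2) * (ct - e) * st * C) + N * S * den);
    [unfold P; field; lra|].
  transitivity (- (N * B)); [|field; split; lra].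
  replace (sg * (N * (1 + d / 2) * (ct - e) * st * C) + N * S * den)
    with (- (N * B) + sg * N * st * e * (S ^ 2 + C ^ 2 - 1))
    by (unfold B, den, ct, st; destruct hsg; subst sg; ring).
  rewrite hSC; ring. }
assert (hu : 11/100 * (d / 2) <= d / 2 * b * st * C - e ^ 2).
{ assert (h1 : 94/100 <= b * st * C).
  { assert (969/1000 <= b * st) by nra. nra. }
  nra. }
assert (hu2 : d / 2 * b * st * C - e ^ 2 <= 102/100 * (d / 2)).
{ assert (h1 : b * st * C <= 102/100).
  { assert (b * st <= 102/100) by nra. nra. }
  nra. }
assert (hv : 0 <= e * st * (1 - C) * (1 - d / 2 * C) <= 105/1000 * (d / 2) * S).
{ assert (0 <= e * st <= 102/100 * (d / 2)) by nra.
  assert (0 <= 1 - d / 2 * C <= 1) by nra.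
  assert (0 <= e * st * (1 - C) <= 102/100 * (d / 2) * (102/1000 * S)).
  { split; [apply Rmult_le_pos | apply Rmult_le_compat]; lra. }
  assert (0 <= d / 2 * S) by nra.
  nra. }
(* The main coefficient is at least [0.11 * (d / 2)] and the correction at most
   [0.105 * (d / 2) * S], which fixes the sign of [B]. The upper constants add to
   [1.02 + 0.105 = 1.125]. *)
assert (hB : 0 <= B <= 1125/1000 * (d / 2) * S).
{ unfold B; destruct hsg; subst sg; nra. }
assert (hBd : 0 <= B / (den * C) <= 124/100 * (d / 2) * S).
{ assert (92/100 <= den * C) by nra.
  split; [apply Rdiv_le_0_compat; lra|].
  apply Rle_div_l; [lra|]. assert (0 <= d / 2 * S) by nra. nra. }
assert (hbS : 0 <= b * S <= S) by nra.
assert (heC : 0 <= e * C <= 18/1000) by nra.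
assert (heC1 : 0 <= e * (1 - C) <= 2/100 * S).
{ split; [apply Rmult_le_pos; lra|].
  assert (e * (1 - C) <= 18/1000 * (1 - C)) by (apply Rmult_le_compat_r; lra); lra. }
assert (hT : Rabs (ct - e) <= 102/100 * S).
{ apply Rabs_le; unfold ct; destruct hsg; subst sg; split; lra. }
assert (hct : Rabs ct <= 22/100).
{ apply Rabs_le; unfold ct; destruct hsg; subst sg; split; lra. }
assert (hQ : Rabs Q <= N * (25/100 * (d / 2) * S)).
{ unfold Q; rewrite Rabs_Ropp.
  replace (N * (d / 2) * (ct - e) * ct / den) with (N * (d / 2 * ((ct - e) * ct) / den))
    by (field; lra).
  rewrite Rabs_mult, (Rabs_pos_eq N) by assumption.
  apply Rmult_le_compat_l; [assumption|].
  unfold Rdiv at 1; rewrite !Rabs_mult, Rabs_inv.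
  rewrite (Rabs_pos_eq (d / 2)), (Rabs_pos_eq den) by lra.
  apply Rle_div_l; [lra|].
  pose proof (Rabs_pos (ct - e)); pose proof (Rabs_pos ct).
  assert (Rabs (ct - e) * Rabs ct <= 225/1000 * S) by nra.
  assert (25/100 * S * (94/100) <= 25/100 * S * den) by nra.
  assert (Rabs (ct - e) * Rabs ct <= 25/100 * S * den) by lra. nra. }
(* The two contributions have constants [1.24 + 0.25 < 3/2], and the factor [d / 2] halves this to
   [3/4]. *)
rewrite hP, Rabs_Ropp, Rabs_mult, (Rabs_pos_eq N), (Rabs_pos_eq (B / _)) by lra.
pose proof (Rmult_le_pos _ _ hN (proj1 hBd)).
pose proof (Rmult_le_compat_l _ _ _ hN (proj2 hBd)).
assert (0 <= N * (d / 2 * S)) by (repeat apply Rmult_le_pos; lra).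
split; lra.
Qed.

(** Bernoulli's inequality [poly] gives [(1 + 1/200) ^ n >= n / 200], and
    [cos (1/5) * (1 + 1/200) ^ 4 <= 1]. Algebraic decay of order four is enough for the tails. *)
Lemma cos_fifth_pow_le (n : nat) : (0 < n)%nat -> cos (1/5) ^ n <= (200 / INR n) ^ 4.
Proof.
intros hn; apply lt_0_INR in hn.
assert (hc : 0 < cos (1/5) <= 98007/100000).
{ destruct (taylor_bounds (1/5)) as [_ [h1 h2]]; [|split]; lra. }
assert (hB : 1 + INR n * (1/200) <= (1 + 1/200) ^ n) by (apply poly; lra).
assert (h : cos (1/5) ^ n * ((1 + 1/200) ^ n) ^ 4 <= 1).
{ rewrite <- pow_mult, Nat.mul_comm, pow_mult, <- Rpow_mult_distr.
  apply Rle_trans with (1 ^ n); [|rewrite pow1; lra].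
  apply pow_incr; split; [apply Rmult_le_pos|]; lra. }
assert (hp : (INR n / 200) ^ 4 <= ((1 + 1/200) ^ n) ^ 4) by (apply pow_incr; split; [|eapply Rle_trans; [|exact hB]]; lra).
assert (hcn : 0 < cos (1/5) ^ n) by (apply pow_lt; lra).
replace ((200 / INR n) ^ 4) with (/ ((INR n / 200) ^ 4)) by (field; lra).
assert (0 < (INR n / 200) ^ 4) by (apply pow_lt; lra).
apply Rmult_le_reg_r with ((INR n / 200) ^ 4); [assumption|].
rewrite Rinv_l by lra.
apply Rle_trans with (2:=h). apply Rmult_le_compat_l; lra.
Qed.

(** * Laplace estimate over the upper half circle *)

Section TwoSided.

Variables (n : nat) (d : R) (X Y : R -> R).
Let N := INR n.
Let e := d / (2 * sqrt (1 + d)).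
Let th0 := acos e.
Let p (th : R) := N * (1 + d / 2) * (cos th - e) * sin th / (sin th ^ 2 + e ^ 2).
Let q (th : R) := - (N * (d / 2) * (cos th - e) * cos th / (sin th ^ 2 + e ^ 2)).
(** The constants fit together: [702 / (36/1000) = 19500]. *)
Hypothesis hN : 19500 <= N.
Hypothesis hd : 0 < d <= 36/1000.
Hypothesis hNd : 702 <= N * d.
Hypothesis hX : forall th, is_derive X th (p th * X th - q th * Y th).
Hypothesis hY : forall th, is_derive Y th (p th * Y th + q th * X th).
Hypothesis h0 : X th0 ^ 2 + Y th0 ^ 2 = 1.

Lemma saddle_cos_eq : 0 < e /\ 4 * (1 + d) * e ^ 2 = d ^ 2.
Proof.
assert (hs : 0 < sqrt (1 + d)) by (apply sqrt_lt_R0; lra).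
split; [unfold e; apply Rdiv_lt_0_compat; lra|].
rewrite <- (pow2_sqrt (1 + d)) at 1 by lra.
unfold e; field; lra.
Qed.

Lemma saddle_cos_small : 0 < e <= 18/1000.
Proof. destruct saddle_cos_eq; split; nra. Qed.

Lemma cos_saddle : cos th0 = e.
Proof. destruct saddle_cos_small; apply cos_acos; lra. Qed.

Lemma sin_saddle : 0 < sin th0 /\ sin th0 ^ 2 = 1 - e ^ 2.
Proof.
destruct saddle_cos_small; unfold th0; rewrite sin_acos by lra.
rewrite pow2_sqrt by (unfold Rsqr; nra).
split; [apply sqrt_lt_R0|]; unfold Rsqr; nra.
Qed.

(** Makes both arcs from the saddle at least as long as the window: [cos th0] is at most [0.018],
    far below [cos (1/5) >= 0.98]. *)
Lemma saddle_interior : 1/5 <= th0 <= PI - 1/5.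
Proof.
destruct saddle_cos_small, sin_saddle; pose proof (acos_bound e) as hb; fold th0 in hb.
pose proof PI2_1; pose proof cos_saddle.
destruct (taylor_bounds (1/5)) as [_ [h _]]; [lra|].
split; apply Rnot_lt_le; intros hlt.
- assert (cos (1/5) <= cos th0) by (apply cos_decr_1; lra); lra.
- assert (cos th0 <= cos (PI - 1/5)) by (apply cos_decr_1; lra).
  replace (PI - 1/5) with (- (1/5) + PI) in * by ring.
  rewrite neg_cos, cos_neg in *; lra.
Qed.

Lemma denominator_pos th : 0 < sin th ^ 2 + e ^ 2.
Proof. destruct saddle_cos_small; pose proof (pow2_ge_0 (sin th)); nra. Qed.

(** The addition formulas put the point into the coordinates of [log_derivative_bounds], and
    [sin s <= s] gives the bound in [s]. *)
Lemma near_saddle_bounds (sg s : R) : sg = 1 \/ sg = -1 -> 0 <= s <= 1/5 ->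
  sg * p (th0 + sg * s) + N * (sin s / cos s) <= 0 /\
  Rabs (sg * p (th0 + sg * s) + N * (sin s / cos s)) + Rabs (q (th0 + sg * s))
  <= 3 / 4 * (N * d) * s.
Proof.
intros hsg hs; destruct (taylor_bounds s hs) as [[h1 h2] [h3 h4]].
destruct saddle_cos_eq, sin_saddle.
assert (0 <= sin s) by nra.
assert (hcs : cos (sg * s) = cos s).
{ destruct hsg; subst sg; [now rewrite Rmult_1_l|].
  replace (-1 * s) with (- s) by ring; apply cos_neg. }
assert (hss : sin (sg * s) = sg * sin s).
{ destruct hsg; subst sg; [now rewrite !Rmult_1_l|].
  replace (-1 * s) with (- s) by ring; rewrite sin_neg; ring. }
assert (hct : cos (th0 + sg * s) = e * cos s - sin th0 * (sg * sin s))
  by (rewrite cos_plus, hcs, hss, cos_saddle; ring).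
assert (hst : sin (th0 + sg * s) = sin th0 * cos s + e * (sg * sin s))
  by (rewrite sin_plus, hcs, hss, cos_saddle; ring).
destruct (log_derivative_bounds N d e (sin th0) (sin s) (cos s) sg) as [r1 r2]; try lra.
- pose proof (sin2_cos2 s) as h; unfold Rsqr in h; lra.
- nra.
- unfold p, q; rewrite hct, hst; split; [exact r1|].
  eapply Rle_trans; [exact r2|]; apply Rmult_le_compat_l; lra.
Qed.

(** The cosine decreases on [[0, PI]] and equals [e] at [th0], so [cos th - e] has the sign opposite
    to [sg], while [sin th] is nonnegative. *)
Lemma log_modulus_derivative_sign (sg s : R) : sg = 1 \/ sg = -1 -> 0 <= s ->
  0 <= th0 + sg * s <= PI -> sg * p (th0 + sg * s) <= 0.
Proof.
intros hsg hs hth; set (th := th0 + sg * s) in *.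
pose proof (acos_bound e) as hb; fold th0 in hb.
assert (0 <= sin th) by (apply sin_ge_0; lra).
assert (hsc : sg * (cos th - e) <= 0).
{ rewrite <- cos_saddle; destruct hsg; subst sg; unfold th in *.
  - assert (cos (th0 + 1 * s) <= cos th0) by (apply cos_decr_1; lra); lra.
  - assert (cos th0 <= cos (th0 + -1 * s)) by (apply cos_decr_1; lra); lra. }
unfold p; pose proof (denominator_pos th).
replace (sg * _) with
  (- (N * (1 + d / 2) * sin th * (- (sg * (cos th - e))) / (sin th ^ 2 + e ^ 2)))
  by (field; lra).
assert (0 <= N * (1 + d / 2) * sin th * (- (sg * (cos th - e))) / (sin th ^ 2 + e ^ 2)).
{ apply Rdiv_le_0_compat; [|assumption]; repeat apply Rmult_le_pos; lra. }
lra.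
Qed.

(** The substitution [th = th0 + sg * s] multiplies [p] and [q] by [sg]; the one-sided estimate then
    applies with [K = 3 / 4 * (N * d)]. *)
Lemma half_integral (sg b : R) : sg = 1 \/ sg = -1 -> 1/5 <= b ->
  0 <= th0 + sg * b <= PI ->
  Rabs (RInt (fun s => X (th0 + sg * s)) 0 b - X th0 * wallis n)
  <= 51/100 * (3 / 4 * (N * d)) * (wallis n / (N + 2)) + (b + 2) * cos (1/5) ^ n.
Proof.
intros hsg hb hth.
pose proof (acos_bound e) as hab; fold th0 in hab.
replace (X th0) with (X (th0 + sg * 0)) by (f_equal; ring).
apply (one_sided_laplace n (fun s => X (th0 + sg * s)) (fun s => Y (th0 + sg * s))
         (fun s => sg * p (th0 + sg * s)) (fun s => sg * q (th0 + sg * s))).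
- assumption.
- lra.
- intros s _.
  replace (sg * p (th0 + sg * s) * X (th0 + sg * s) - sg * q (th0 + sg * s) * Y (th0 + sg * s))
    with (sg * (p (th0 + sg * s) * X (th0 + sg * s) - q (th0 + sg * s) * Y (th0 + sg * s)))
    by ring.
  apply (is_derive_comp (K := R_AbsRing) (V := R_NormedModule) X (fun s => th0 + sg * s)); [apply hX|].
  auto_derive; trivial; ring.
- intros s _.
  replace (sg * p (th0 + sg * s) * Y (th0 + sg * s) + sg * q (th0 + sg * s) * X (th0 + sg * s))
    with (sg * (p (th0 + sg * s) * Y (th0 + sg * s) + q (th0 + sg * s) * X (th0 + sg * s)))
    by ring.
  apply (is_derive_comp (K := R_AbsRing) (V := R_NormedModule) Y (fun s => th0 + sg * s)); [apply hY|].
  auto_derive; trivial; ring.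
- replace (th0 + sg * 0) with th0 by ring; exact h0.
- intros s hs; apply log_modulus_derivative_sign; [assumption|lra|].
  destruct hsg; subst sg; lra.
- intros s hs; now apply near_saddle_bounds.
- intros s hs; destruct (near_saddle_bounds sg s hsg hs) as [_ h].
  fold N; replace (Rabs (sg * q (th0 + sg * s))) with (Rabs (q (th0 + sg * s))); [exact h|].
  rewrite Rabs_mult; replace (Rabs sg) with 1; [ring|].
  destruct hsg; subst sg; [now rewrite Rabs_R1 | now rewrite Rabs_left by lra; ring].
Qed.

(** Sum of the two sides: [2 * 0.51 * 0.75 = 0.765], and the tail coefficients [th0 + 2] and
    [PI - th0 + 2] add up to at most [8]. *)
Lemma full_integral :
  Rabs (RInt X 0 PI - 2 * X th0 * wallis n)
  <= 77/100 * (N * d) * (wallis n / (N + 2)) + 8 * cos (1/5) ^ n.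
Proof.
pose proof saddle_interior as hi; pose proof PI_4.
assert (hex : forall a b, ex_RInt X a b).
{ intros a b; apply (ex_RInt_continuous (V := R_CompleteNormedModule)); intros th _.
  apply (ex_derive_continuous X); eexists; apply hX. }
assert (hr : RInt (fun s => X (th0 + 1 * s)) 0 (PI - th0) = RInt X th0 PI).
{ replace (RInt X th0 PI) with (RInt X (1 * 0 + th0) (1 * (PI - th0) + th0))
    by (f_equal; ring).
  rewrite <- (RInt_comp_lin (V := R_CompleteNormedModule)) by apply hex.
  apply RInt_ext; intros s _; unfold scal; simpl; unfold mult; simpl.
  rewrite !Rmult_1_l, Rplus_comm; reflexivity. }
assert (hl : RInt (fun s => X (th0 + -1 * s)) 0 th0 = RInt X 0 th0).
{ rewrite <- (Ropp_involutive (RInt X 0 th0)).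
  change (- RInt X 0 th0) with (opp (RInt X 0 th0)).
  rewrite (opp_RInt_swap (V := R_CompleteNormedModule)) by apply hex.
  replace (RInt X th0 0) with (RInt X (-1 * 0 + th0) (-1 * th0 + th0))
    by (f_equal; ring).
  rewrite <- (RInt_comp_lin (V := R_CompleteNormedModule)) by apply hex.
  change (- RInt ?f 0 th0) with (opp (RInt f 0 th0)).
  rewrite <- (RInt_opp (V := R_CompleteNormedModule)).
  - apply RInt_ext; intros s _; unfold scal, opp; simpl; unfold mult; simpl.
    replace (-1 * s + th0) with (th0 + -1 * s) by ring; ring.
  - apply (ex_RInt_comp_lin (V := R_NormedModule)), hex. }
pose proof (half_integral 1 (PI - th0)) as h1; rewrite hr in h1.
pose proof (half_integral (-1) th0) as h2; rewrite hl in h2.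
specialize (h1 (or_introl eq_refl)); specialize (h2 (or_intror eq_refl)).
assert (h1' := h1 ltac:(lra) ltac:(lra)); assert (h2' := h2 ltac:(lra) ltac:(lra)).
rewrite <- (RInt_Chasles (V := R_CompleteNormedModule) X 0 th0 PI) by apply hex.
change (plus ?a ?b) with (a + b).
apply Rabs_le_between in h1'; apply Rabs_le_between in h2'.
assert (0 < cos (1/5) ^ n) by (apply pow_lt, cos_small_pos; lra).
assert (0 <= N * d * (wallis n / (N + 2))).
{ apply Rmult_le_pos; [lra|]; apply Rdiv_le_0_compat; [apply wallis_nonneg | lra]. }
assert (PI * cos (1/5) ^ n <= 4 * cos (1/5) ^ n) by (apply Rmult_le_compat_r; lra).
apply Rabs_le; lra.
Qed.

(** The factor [sqrt (N / (2 * PI))] is close to [1 / (2 * wallis n)]. The error consists of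
    [0.385 * d] from the second moment, [34 / N] from the tails and [1 / N] from the normalisation.
    Since [N * d >= 702], the last two are at most [0.05 * d]. *)
Lemma normalized_integral :
  Rabs (sqrt (N / (2 * PI)) * RInt X 0 PI - X th0) <= 44/100 * d.
Proof.
pose proof PI2_1; pose proof PI_4.
assert (hn : (0 < n)%nat) by (apply INR_lt; simpl; fold N; lra).
set (r := sqrt (N / (2 * PI))); set (w := wallis n).
assert (hr : 0 < r) by (apply sqrt_lt_R0, Rdiv_lt_0_compat; lra).
assert (hr2 : r ^ 2 * (2 * PI) = N).
{ unfold r; rewrite pow2_sqrt; [field; lra | apply Rdiv_le_0_compat; lra]. }
assert (hrN : r <= N) by nra.
pose proof (wallis_nonneg n) as hw; fold w in hw.
pose proof (wallis_sqr_le n) as hw1; pose proof (wallis_sqr_ge n) as hw2; fold N w in hw1, hw2.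
assert (hrw : 0 <= r * w) by nra.
assert (hrw1 : 2 * (r * w) <= 1).
{ assert ((2 * (r * w)) ^ 2 <= 1); [|nra].
  apply Rmult_le_reg_r with (N * (PI / 2)); [apply Rmult_lt_0_compat; lra|].
  replace ((2 * (r * w)) ^ 2 * (N * (PI / 2))) with ((r ^ 2 * (2 * PI)) * (N * w ^ 2)) by field.
  rewrite hr2, Rmult_1_l; apply Rmult_le_compat_l; lra. }
(* A lower bound for the square of [2 * (r * w)] also bounds the number itself, which is at most
   [1]. *)
assert (hrw2 : 1 - 1 / N <= 2 * (r * w)).
{ assert (h : N / (N + 1) <= (2 * (r * w)) ^ 2).
  { apply Rle_div_l; [lra|].
    apply Rmult_le_reg_r with (PI / 2); [lra|].
    replace ((2 * (r * w)) ^ 2 * (N + 1) * (PI / 2))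
      with ((r ^ 2 * (2 * PI)) * ((N + 1) * w ^ 2)) by field.
    rewrite hr2; nra. }
  assert (1 - 1 / N <= N / (N + 1)).
  { apply Rle_div_r; [lra|]. assert (0 < 1 / N) by (apply Rdiv_lt_0_compat; lra).
    replace ((1 - 1 / N) * (N + 1)) with (N - 1 / N) by (field; lra). lra. }
  nra. }
(* The crude [r <= N] suffices against fourth-order decay: there remains [1.28e10 / N ^ 2] times
   [1 / N], and [N >= 19500] makes the first factor at most [34]. *)
assert (hc : r * (8 * cos (1/5) ^ n) <= 34 / N).
{ apply Rle_trans with (N * (8 * (200 / N) ^ 4)).
  - pose proof (cos_fifth_pow_le n hn) as h; fold N in h.
    assert (0 < cos (1/5) ^ n) by (apply pow_lt, cos_small_pos; lra).
    apply Rmult_le_compat; lra.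
  - replace (N * (8 * (200 / N) ^ 4)) with (12800000000 / N ^ 2 / N) by (field; lra).
    apply Rmult_le_compat_r; [left; apply Rinv_0_lt_compat; lra|].
    apply Rle_div_l; nra. }
assert (hX1 : Rabs (X th0) <= 1) by (apply (Rabs_le_1_of_sqr _ (Y th0)); lra).
assert (hmain : r * (77/100 * (N * d) * (w / (N + 2))) <= 385/1000 * d).
{ replace (r * (77/100 * (N * d) * (w / (N + 2))))
    with (77/100 * d * ((r * w) * (N / (N + 2)))) by (field; lra).
  assert (0 <= N / (N + 2) <= 1).
  { split; [apply Rdiv_le_0_compat; lra | apply Rle_div_l; lra]. }
  assert ((r * w) * (N / (N + 2)) <= 1 / 2) by nra. nra. }
replace (r * RInt X 0 PI - X th0)
  with (r * (RInt X 0 PI - 2 * X th0 * w) + X th0 * (2 * (r * w) - 1)) by ring.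
eapply Rle_trans; [apply Rabs_triang|].
rewrite !Rabs_mult, (Rabs_pos_eq r) by lra.
rewrite (Rabs_left1 (2 * (r * w) - 1)) by lra.
pose proof full_integral as hf; fold w in hf.
apply (Rmult_le_compat_l r) in hf; [|lra].
rewrite Rmult_plus_distr_l in hf.
assert (35 / N <= 5/100 * d).
{ apply Rle_div_l; lra. }
assert (Rabs (X th0) * - (2 * (r * w) - 1) <= 1 / N).
{ pose proof (Rabs_pos (X th0)); nra. }
replace (35 / N) with (34 / N + 1 / N) in * by (field; lra).
lra.
Qed.

End TwoSided.

(** * Logarithmic derivatives of complex-valued functions *)

(* Stated multiplicatively and componentwise, so that no complex logarithm is needed. *)
Definition has_log_derive (f : R -> C) (t : R) (u : C) : Prop :=
  is_derive (fun s => fst (f s)) t (fst (f t * u)%C) /\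
  is_derive (fun s => snd (f s)) t (snd (f t * u)%C).

Lemma has_log_derive_const (c : C) (t : R) : has_log_derive (fun _ => c) t 0.
Proof.
split; rewrite Cmult_0_r; simpl; auto_derive; trivial.
Qed.

(** The shape of the real part of a complex product; the next lemma serves the imaginary part. The
    free [l] reduces the match with the complex formula to [ring]. *)
Lemma is_derive_mult_minus (a b c e : R -> R) (t a' b' c' e' l : R) :
  is_derive a t a' -> is_derive b t b' -> is_derive c t c' -> is_derive e t e' ->
  l = a' * b t + a t * b' - (c' * e t + c t * e') ->
  is_derive (fun s => a s * b s - c s * e s) t l.
Proof.
intros ha hb hc he ->; auto_derive; [repeat split; eexists; eassumption|].
replace (Derive (fun x : R => a x) t) with a'
    by (symmetry; now apply is_derive_unique).
replace (Derive (fun x : R => b x) t) with b'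
    by (symmetry; now apply is_derive_unique).
replace (Derive (fun x : R => c x) t) with c'
    by (symmetry; now apply is_derive_unique).
replace (Derive (fun x : R => e x) t) with e'
    by (symmetry; now apply is_derive_unique).
  ring.
Qed.

Lemma is_derive_mult_plus (a b c e : R -> R) (t a' b' c' e' l : R) :
  is_derive a t a' -> is_derive b t b' -> is_derive c t c' -> is_derive e t e' ->
  l = a' * b t + a t * b' + (c' * e t + c t * e') ->
  is_derive (fun s => a s * b s + c s * e s) t l.
Proof.
intros ha hb hc he ->; auto_derive; [repeat split; eexists; eassumption|].
replace (Derive (fun x : R => a x) t) with a'
    by (symmetry; now apply is_derive_unique).
replace (Derive (fun x : R => b x) t) with b'
    by (symmetry; now apply is_derive_unique).
replace (Derive (fun x : R => c x) t) with c'
    by (symmetry; now apply is_derive_unique).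
replace (Derive (fun x : R => e x) t) with e'
    by (symmetry; now apply is_derive_unique).
  ring.
Qed.

Lemma has_log_derive_mult (f g : R -> C) (t : R) (u v : C) :
  has_log_derive f t u -> has_log_derive g t v ->
  has_log_derive (fun s => f s * g s)%C t (u + v)%C.
Proof.
intros [hf1 hf2] [hg1 hg2]; split.
- eapply (is_derive_mult_minus (fun s => fst (f s)) (fun s => fst (g s))
            (fun s => snd (f s)) (fun s => snd (g s))); [eassumption .. | simpl; ring].
- eapply (is_derive_mult_plus (fun s => fst (f s)) (fun s => snd (g s))
            (fun s => snd (f s)) (fun s => fst (g s))); [eassumption .. | simpl; ring].
Qed.

Lemma has_log_derive_pow (f : R -> C) (t : R) (u : C) (n : nat) :
  has_log_derive f t u -> has_log_derive (fun s => f s ^ n)%C t (INR n * u)%C.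
Proof.
intros hf; induction n as [|n IH].
- replace (RtoC (INR 0) * u)%C with (RtoC 0) by (simpl; ring).
  apply (has_log_derive_const 1).
- replace (RtoC (INR (S n)) * u)%C with (u + INR n * u)%C
    by (rewrite S_INR, RtoC_plus; ring).
  apply (has_log_derive_mult f (fun s => f s ^ n)%C); assumption.
Qed.

Lemma sqr_norm_neq_0 (c : C) : c <> 0 -> fst c ^ 2 + snd c ^ 2 <> 0.
Proof.
intros hc h; apply hc; destruct c as [a b]; simpl in h.
assert (a = 0) by nra; assert (b = 0) by nra; now subst.
Qed.

(** The common shape of both components of a complex inverse, with [k = 1] for the real and [k = -1]
    for the imaginary part. *)
Lemma is_derive_div_sqr_norm (a b : R -> R) (t k a' b' l : R) :
  a t ^ 2 + b t ^ 2 <> 0 -> is_derive a t a' -> is_derive b t b' ->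
  l = k * (a' / (a t ^ 2 + b t ^ 2)
           - a t * (2 * a t * a' + 2 * b t * b') / (a t ^ 2 + b t ^ 2) ^ 2) ->
  is_derive (fun s => k * a s / (a s ^ 2 + b s ^ 2)) t l.
Proof.
intros h0 ha hb ->; auto_derive.
- repeat split; try (eexists; eassumption); intro h; apply h0; rewrite <- h; ring.
- replace (Derive (fun x : R => a x) t) with a'
    by (symmetry; now apply is_derive_unique).
  replace (Derive (fun x : R => b x) t) with b'
    by (symmetry; now apply is_derive_unique).
  field; exact h0.
Qed.

Lemma has_log_derive_inv (f : R -> C) (t : R) (u : C) :
  f t <> 0 -> has_log_derive f t u -> has_log_derive (fun s => / f s)%C t (- u)%C.
Proof.
intros h0 [hf1 hf2]; apply sqr_norm_neq_0 in h0; split.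
- apply (is_derive_ext (fun s => 1 * fst (f s) / (fst (f s) ^ 2 + snd (f s) ^ 2)));
    [intros s; simpl; now rewrite Rmult_1_l|].
  eapply (is_derive_div_sqr_norm (fun s => fst (f s)) (fun s => snd (f s)));
    [exact h0 | eassumption | eassumption | simpl; field].
  intros h; apply h0; rewrite <- h; ring.
- apply (is_derive_ext (fun s => -1 * snd (f s) / (snd (f s) ^ 2 + fst (f s) ^ 2))).
  { intros s; simpl; rewrite (Rplus_comm (snd (f s) * _)); f_equal; ring. }
  rewrite Rplus_comm in h0.
  eapply (is_derive_div_sqr_norm (fun s => snd (f s)) (fun s => fst (f s)));
    [exact h0 | eassumption | eassumption | simpl; field].
  repeat split; intros h; apply h0; rewrite <- h; ring.
Qed.

(** * Polar forms and integrals over symmetric intervals *)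

Lemma Cexpi_plus (a b : R) : Cexpi (a + b) = (Cexpi a * Cexpi b)%C.
Proof.
unfold Cexpi, Cmult; simpl; f_equal; [apply cos_plus | rewrite sin_plus; ring].
Qed.

Lemma Cexpi_pow (a : R) (n : nat) : (Cexpi a ^ n)%C = Cexpi (INR n * a).
Proof.
induction n as [|n IH].
- simpl; unfold Cexpi; rewrite Rmult_0_l, cos_0, sin_0; reflexivity.
- rewrite S_INR, Cpow_S, IH, <- Cexpi_plus; f_equal; ring.
Qed.

(** The principal arccosine has nonnegative sine, so the sign of [y] decides between [acos] and its
    negative: [gamma1] needs the former, [gamma2] the latter. *)
Lemma acos_polar (x y : R) : x ^ 2 + y ^ 2 = 2 -> 0 <= y ->
  (x, y) = (RtoC (sqrt 2) * Cexpi (acos (x / sqrt 2)))%C.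
Proof.
intros hxy hy; pose proof Rlt_sqrt2_0 as hs; pose proof (pow2_sqrt 2) as hs2.
assert (hx : -1 <= x / sqrt 2 <= 1).
{ split; [apply Rle_div_r | apply Rle_div_l]; nra. }
assert (hy2 : sin (acos (x / sqrt 2)) = y / sqrt 2).
{ rewrite sin_acos by assumption; apply sqrt_lem_1; unfold Rsqr.
  - nra.
  - apply Rdiv_le_0_compat; assumption.
  - replace (y / sqrt 2 * (y / sqrt 2)) with (y ^ 2 / sqrt 2 ^ 2) by (field; lra).
    replace (x / sqrt 2 * (x / sqrt 2)) with (x ^ 2 / sqrt 2 ^ 2) by (field; lra).
    rewrite hs2 by lra; lra. }
unfold Cexpi, Cmult, RtoC; simpl; rewrite hy2, cos_acos by assumption.
f_equal; field; lra.
Qed.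

Lemma acos_polar_conj (x y : R) : x ^ 2 + y ^ 2 = 2 -> y <= 0 ->
  (x, y) = (RtoC (sqrt 2) * Cexpi (- acos (x / sqrt 2)))%C.
Proof.
intros hxy hy; assert (h : (x, - y) = (RtoC (sqrt 2) * Cexpi (acos (x / sqrt 2)))%C)
  by (apply acos_polar; nra).
unfold Cexpi in *; rewrite cos_neg, sin_neg.
unfold Cmult, RtoC in *; simpl in *; injection h; intros h2 h1.
f_equal; lra.
Qed.

Lemma Cmult_cancel_r (a b c : C) : c <> 0 -> (a * c = b * c)%C -> a = b.
Proof.
intros hc h; replace a with (a * c * / c)%C by (field; exact hc).
rewrite h; field; exact hc.
Qed.

Lemma RInt_even (f : R -> R) (a : R) : (forall x, f (- x) = f x) ->
  (forall u v, ex_RInt f u v) -> RInt f (- a) a = 2 * RInt f 0 a.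
Proof.
intros hf hex.
rewrite <- (RInt_Chasles (V := R_CompleteNormedModule) f (- a) 0 a) by apply hex.
assert (h : RInt f (- a) 0 = RInt f 0 a).
{ apply (is_RInt_unique (V := R_CompleteNormedModule)).
  rewrite <- (Ropp_involutive (RInt f 0 a)).
  apply (is_RInt_ext (fun x => opp (opp (f (- x))))).
  { intros x _; rewrite <- (hf x); apply Ropp_involutive. }
  apply (is_RInt_opp (V := R_NormedModule)), (is_RInt_comp_opp (V := R_NormedModule)).
  rewrite Ropp_involutive, Ropp_0; apply (is_RInt_swap (V := R_NormedModule)).
  apply (RInt_correct (V := R_CompleteNormedModule)), hex. }
rewrite h; unfold plus; simpl; ring.
Qed.

Lemma RInt_odd (f : R -> R) (a : R) : (forall x, f (- x) = - f x) ->
  (forall u v, ex_RInt f u v) -> RInt f (- a) a = 0.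
Proof.
intros hf hex.
assert (h : RInt f (- a) a = - RInt f (- a) a).
{ apply (is_RInt_unique (V := R_CompleteNormedModule)).
  apply (is_RInt_ext (fun x => opp (f (- x)))).
  { intros x _; rewrite hf; apply Ropp_involutive. }
  apply (is_RInt_comp_opp (V := R_NormedModule)).
  rewrite Ropp_involutive; apply (is_RInt_swap (V := R_NormedModule)).
  apply (RInt_correct (V := R_CompleteNormedModule)), hex. }
lra.
Qed.

Lemma Rpower_half (m : nat) : Rpower 2 (INR m / 2) = sqrt 2 ^ m.
Proof.
rewrite <- Rpower_sqrt by lra.
rewrite <- Rpower_pow by apply exp_pos.
rewrite Rpower_mult; f_equal; field.
Qed.

(** * The integrand on the circle through the saddles *)

Section Integrand.

Variables l1 l2 : nat.
Hypothesis hl2 : (0 < l2)%nat.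
Hypothesis hl12 : INR l2 < INR l1.

Let N := INR l2.
Let d := INR l1 / INR l2 - 1.
Let e := d / (2 * sqrt (1 + d)).
Let th0 := acos e.
Let r := rho l1 l2.
(** Coordinates instead of an angle turn identities on the circle into algebraic ones under
    [s ^ 2 + c ^ 2 = 1]. *)
Let circ (c s : R) : C := (r * c, r * s).
Let p (th : R) := N * (1 + d / 2) * (cos th - e) * sin th / (sin th ^ 2 + e ^ 2).
Let q (th : R) := - (N * (d / 2) * (cos th - e) * cos th / (sin th ^ 2 + e ^ 2)).

Lemma l2_pos : 0 < N.
Proof. now apply lt_0_INR. Qed.

Lemma d_pos : 0 < d.
Proof.
pose proof l2_pos; unfold d; fold N in hl12 |- *.
assert (1 < INR l1 / N) by (apply Rlt_div_r; lra); lra.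
Qed.

Lemma l1_eq : INR l1 = N * (1 + d).
Proof. pose proof l2_pos; unfold d; fold N; field; lra. Qed.

Lemma rho_spec : 0 < r < 1 /\ r ^ 2 * (1 + d) = 1 /\ e = d * r / 2.
Proof.
pose proof d_pos.
assert (hs : 1 < sqrt (1 + d)) by (rewrite <- sqrt_1 at 1; apply sqrt_lt_1; lra).
assert (hr : r = 1 / sqrt (1 + d)) by (unfold r, rho; do 2 f_equal; unfold d; ring).
repeat split.
- rewrite hr; apply Rdiv_lt_0_compat; lra.
- rewrite hr; apply Rlt_div_l; lra.
- rewrite hr; rewrite <- (pow2_sqrt (1 + d)) at 2 by lra; field; lra.
- rewrite hr; unfold e; field; lra.
Qed.

Lemma circle_point_neq (c s : R) : s ^ 2 + c ^ 2 = 1 ->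
  (1 + circ c s)%C <> 0 /\ (1 - circ c s)%C <> 0 /\ (circ c s) <> 0.
Proof.
intros h; destruct rho_spec as [hr _].
repeat split; intros hz; unfold circ, Cplus, Cminus, Copp, RtoC in hz; simpl in hz;
  injection hz; intros h2 h1.
- assert (s = 0) by nra; subst s; nra.
- assert (s = 0) by nra; subst s; nra.
- nra.
Qed.

Lemma denominator_neq_0 (s : R) : s ^ 2 + e ^ 2 <> 0.
Proof.
destruct rho_spec as [hr [_ he]]; pose proof d_pos.
assert (0 < e) by (rewrite he; apply Rdiv_lt_0_compat; nra). nra.
Qed.

(* The logarithmic derivative equals [- i l1 (z - z0) (z - conj z0) / (1 - z ^ 2)], and
   [(z - z0) (z - conj z0) = 2 rho z (cos th - e)] on the circle [|z| = rho]. *)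
Lemma saddle_factorization (c s : R) : s ^ 2 + c ^ 2 = 1 ->
  ((N * (1 + d / 2) * (c - e) * s / (s ^ 2 + e ^ 2),
     - (N * (d / 2) * (c - e) * c / (s ^ 2 + e ^ 2))) : C)
  = (INR l1 * (Ci * circ c s / (1 + circ c s))
     + INR l2 * (- (Ci * circ c s) / (1 - circ c s)) - INR l2 * Ci)%C.
Proof.
intros h; destruct (circle_point_neq c s h) as [h1 [h2 _]].
destruct rho_spec as [hr [hrd he]]; pose proof d_pos; pose proof (denominator_neq_0 s) as hden.
set (z := circ c s) in *.
apply (Cmult_cancel_r _ _ ((1 + z) * (1 - z))%C); [now apply Cmult_neq_0|].
transitivity (INR l1 * (Ci * z * (1 - z)) - INR l2 * (Ci * z * (1 + z))
              - INR l2 * Ci * ((1 + z) * (1 - z)))%C; [|field; now split].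
assert (hr2 : r ^ 2 = / (1 + d)).
{ apply (Rmult_eq_reg_r (1 + d)); [|lra]; rewrite hrd; field; lra. }
assert (he2 : e ^ 2 = d ^ 2 / (4 * (1 + d))).
{ rewrite he; replace ((d * r / 2) ^ 2) with (r ^ 2 * d ^ 2 / 4) by field.
  rewrite hr2; field; lra. }
assert (hc2 : c ^ 2 = 1 - s ^ 2) by lra.
(* After multiplication by [1 - z ^ 2], the bracket in each component of the left side is twice the
   denominator, which therefore cancels. *)
assert (hre : (1 + d / 2) * (1 - r ^ 2 * (c ^ 2 - s ^ 2)) - d * r ^ 2 * c ^ 2
              = 2 * (s ^ 2 + e ^ 2)) by (rewrite hr2, he2, hc2; field; lra).
assert (him : (d / 2) * (1 - r ^ 2 * (c ^ 2 - s ^ 2)) + (1 + d / 2) * (2 * r ^ 2 * s ^ 2)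
              = 2 * (s ^ 2 + e ^ 2)) by (rewrite hr2, he2, hc2; field; lra).
(* The common value of both sides is [- 2 i N (c - e) (c + i s)]. *)
transitivity ((2 * N * (c - e) * s, - (2 * N * (c - e) * c)) : C).
- unfold z, circ, Cmult, Cplus, Cminus, Copp, RtoC; simpl; f_equal.
  + transitivity (N * (c - e) * s / (s ^ 2 + e ^ 2)
      * ((1 + d / 2) * (1 - r ^ 2 * (c ^ 2 - s ^ 2)) - d * r ^ 2 * c ^ 2));
      [field; exact hden | rewrite hre; field; exact hden].
  + transitivity (- (N * (c - e) * c / (s ^ 2 + e ^ 2)
      * ((d / 2) * (1 - r ^ 2 * (c ^ 2 - s ^ 2)) + (1 + d / 2) * (2 * r ^ 2 * s ^ 2))));
      [field; exact hden | rewrite him; field; exact hden].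
- rewrite l1_eq; unfold z, circ, Cmult, Cplus, Cminus, Copp, RtoC, Ci; simpl; fold N.
  apply injective_projections; simpl.
  + transitivity (N * (2 * (r ^ 2 * (1 + d)) * c * s - d * r * s)).
    * rewrite hrd, he; field.
    * ring.
  + transitivity (- (N * ((r ^ 2 * (1 + d)) * (c ^ 2 - s ^ 2) - d * r * c + 1))).
    * rewrite hrd, he, hc2.
      replace (- (2 * N * (c - d * r / 2) * c)) with (- (N * (2 * c ^ 2 - d * r * c))) by field.
      rewrite hc2; ring.
    * ring.
Qed.

Lemma integrand_log_derive (t : R) : has_log_derive (integrand l1 l2) t (p t, q t).
Proof.
assert (hsc : sin t ^ 2 + cos t ^ 2 = 1)
  by (pose proof (sin2_cos2 t) as h; unfold Rsqr in h; lra).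
set (z := fun t => (RtoC r * Cexpi t)%C).
assert (hz : forall t, z t = circ (cos t) (sin t)).
{ intros x; unfold z, circ, Cmult, RtoC, Cexpi; simpl; f_equal; ring. }
destruct (circle_point_neq _ _ hsc) as [h1 [h2 h3]]; rewrite <- hz in h1, h2, h3.
unfold p, q; rewrite (saddle_factorization _ _ hsc), <- hz.
(* The sum is put in the form the product rule yields: the last two terms belong to [/ z ^ l2] and
   to the constant factor. *)
replace (_ - _)%C with
  (INR l1 * (Ci * z t / (1 + z t)) + INR l2 * (- (Ci * z t) / (1 - z t))
   + - (INR l2 * Ci) + 0)%C by ring.
assert (dz : has_log_derive z t Ci).
{ split; simpl; auto_derive; trivial; ring. }
unfold integrand; fold r.
apply (has_log_derive_mult
  (fun t => (1 + z t) ^ l1 * (1 - z t) ^ l2 * / z t ^ l2)%C (fun _ => RtoC (/ (2 * PI))));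
  [|apply has_log_derive_const].
apply (has_log_derive_mult (fun t => (1 + z t) ^ l1 * (1 - z t) ^ l2)%C
  (fun t => / z t ^ l2)%C).
- apply (has_log_derive_mult (fun t => (1 + z t) ^ l1)%C (fun t => (1 - z t) ^ l2)%C).
  + apply (has_log_derive_pow (fun t => 1 + z t)%C).
    unfold has_log_derive.
    replace ((1 + z t) * (Ci * z t / (1 + z t)))%C with (z t * Ci)%C by (field; exact h1).
    destruct dz as [d1 d2]; split; simpl.
    * auto_derive; trivial; ring.
    * auto_derive; trivial; ring.
  + apply (has_log_derive_pow (fun t => 1 - z t)%C).
    unfold has_log_derive.
    replace ((1 - z t) * (- (Ci * z t) / (1 - z t)))%C with (- (z t * Ci))%C
      by (field; exact h2).
    split; simpl; auto_derive; trivial; ring.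
- apply (has_log_derive_inv (fun t => z t ^ l2)%C); [now apply Cpow_nz|].
  now apply has_log_derive_pow.
Qed.

(** Negating [t] conjugates [z], and the integrand is a rational function of [z] with real
    coefficients. Its real part is thus even and its imaginary part odd, which leaves the upper half
    circle with its single saddle. *)
Lemma integrand_conj (t : R) : integrand l1 l2 (- t) = Cconj (integrand l1 l2 t).
Proof.
destruct (circle_point_neq (cos t) (sin t)) as [_ [_ h3]].
{ pose proof (sin2_cos2 t) as h; unfold Rsqr in h; lra. }
assert (hz : (RtoC r * Cexpi (- t))%C = Cconj (RtoC r * Cexpi t)).
{ unfold Cexpi, Cmult, Cconj, RtoC; simpl; rewrite cos_neg, sin_neg; f_equal; ring. }
unfold integrand; fold r; rewrite hz.
set (z := (RtoC r * Cexpi t)%C) in *.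
assert (hz0 : z <> 0).
{ unfold z; intros h; apply h3; rewrite <- h; unfold circ, Cexpi, Cmult, RtoC; simpl; f_equal; ring. }
rewrite !Cmult_conj, Cinv_conj, !Cpow_conj by now apply Cpow_nz.
rewrite Cplus_conj, Cminus_conj.
replace (Cconj 1) with (RtoC 1) by (unfold Cconj, RtoC; simpl; f_equal; ring).
replace (Cconj (/ (2 * PI))%R) with (RtoC (/ (2 * PI)))
  by (unfold Cconj, RtoC; simpl; f_equal; ring).
reflexivity.
Qed.

Lemma integrand_at_saddle : d <= 36/1000 ->
  integrand l1 l2 th0
  = (RtoC (sqrt 2 ^ (l1 + l2) / (2 * PI))
     * Cexpi (INR l1 * gamma1 l1 l2 + INR l2 * gamma2 l1 l2))%C.
Proof.
intros hsmall; pose proof d_pos as hd; destruct rho_spec as [hr [hrd he]].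
pose proof Rlt_sqrt2_0 as hs2; pose proof l2_pos as hN; pose proof PI_RGT_0.
assert (hr2 : r ^ 2 = / (1 + d)).
{ apply (Rmult_eq_reg_r (1 + d)); [|lra]; rewrite hrd; field; lra. }
assert (hc : cos th0 = e) by (apply cos_saddle; lra).
destruct (sin_saddle d) as [hb hb2]; [lra|]; fold e in hb, hb2; fold th0 in hb, hb2.
set (b := sin th0) in *.
assert (hz : (RtoC r * Cexpi th0)%C = circ e b).
{ unfold circ, Cexpi, Cmult, RtoC; fold b; simpl; rewrite hc; f_equal; ring. }
destruct (circle_point_neq e b) as [_ [_ hz0]]; [lra|].
(* The real part is [1 + r * e = 1 + d / (2 * (1 + d))], which is [(3 * l1 - l2) / (2 * l1)]. *)
assert (h1 : (1 + circ e b)%C = (RtoC (sqrt 2) * Cexpi (gamma1 l1 l2))%C).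
{ unfold gamma1; replace ((3 * INR l1 - INR l2) / (2 * sqrt 2 * INR l1))
    with ((1 + r * e) / sqrt 2).
  - rewrite <- (acos_polar (1 + r * e) (r * b)).
    + unfold circ, Cplus, RtoC; simpl; f_equal; ring.
    + replace ((1 + r * e) ^ 2 + (r * b) ^ 2) with (1 + 2 * r * e + r ^ 2 * (e ^ 2 + b ^ 2)) by ring.
      rewrite hb2, he.
      replace (2 * r * (d * r / 2)) with (r ^ 2 * d) by field; lra.
    + nra.
  - rewrite he; replace (1 + r * (d * r / 2)) with (1 + r ^ 2 * d / 2) by field.
    rewrite hr2, l1_eq; fold N; field; lra. }
(* Here [1 / z0 - 1] has real part [e / r - 1 = d / 2 - 1] and negative imaginary part [- b / r],
   whence the minus sign in [gamma2]. *)
assert (h2 : ((1 - circ e b) * / circ e b)%C = (RtoC (sqrt 2) * Cexpi (gamma2 l1 l2))%C).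
{ unfold gamma2; replace ((INR l1 - 3 * INR l2) / (2 * sqrt 2 * INR l2))
    with ((e / r - 1) / sqrt 2).
  - rewrite <- (acos_polar_conj (e / r - 1) (- (b / r))).
    + apply (Cmult_cancel_r _ _ (circ e b)); [exact hz0|].
      replace ((1 - circ e b) * / circ e b * circ e b)%C with (1 - circ e b)%C
        by (field; exact hz0).
      unfold circ, Cmult, Cminus, Cplus, Copp, RtoC; apply injective_projections; simpl;
        [|field; lra].
      transitivity ((e ^ 2 + b ^ 2) - r * e); [rewrite hb2; ring | field; lra].
    + replace ((e / r - 1) ^ 2 + (- (b / r)) ^ 2)
        with ((e ^ 2 + b ^ 2) / r ^ 2 - 2 * (e / r) + 1) by (field; lra).
      rewrite hb2, hr2, he; field; lra.
    + assert (0 < b / r) by (apply Rdiv_lt_0_compat; lra); lra.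
  - rewrite he, l1_eq; fold N; field; lra. }
unfold integrand; fold r; rewrite hz.
replace ((1 + circ e b) ^ l1 * (1 - circ e b) ^ l2 * / circ e b ^ l2 * RtoC (/ (2 * PI)))%C
  with ((1 + circ e b) ^ l1 * ((1 - circ e b) * / circ e b) ^ l2 * RtoC (/ (2 * PI)))%C
  by (rewrite Cpow_mult_l, Cpow_inv by exact hz0; ring).
rewrite h1, h2, !Cpow_mult_l, !Cexpi_pow, Cexpi_plus, pow_add.
unfold Rdiv; rewrite !RtoC_mult, !RtoC_pow; ring.
Qed.

Lemma ex_RInt_integrand (a b : R) :
  ex_RInt (fun t => fst (integrand l1 l2 t)) a b /\
  ex_RInt (fun t => snd (integrand l1 l2 t)) a b.
Proof.
split; apply (ex_RInt_continuous (V := R_CompleteNormedModule)); intros t _;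
  [apply (ex_derive_continuous (fun t => fst (integrand l1 l2 t)))
  | apply (ex_derive_continuous (fun t => snd (integrand l1 l2 t)))];
  destruct (integrand_log_derive t); eexists; eassumption.
Qed.

Lemma I_int_eq :
  I_int l1 l2 = RtoC (2 * RInt (fun t => fst (integrand l1 l2 t)) 0 PI).
Proof.
unfold I_int; apply (is_RInt_unique (V := C_R_CompleteNormedModule)).
rewrite <- (RInt_even (fun t => fst (integrand l1 l2 t))).
2: { intros t; rewrite integrand_conj; reflexivity. }
2: { intros; apply ex_RInt_integrand. }
(* The zero imaginary part is rewritten as the integral of an odd function, so that the pair can be
   integrated componentwise. *)
unfold RtoC; rewrite <- (RInt_odd (fun t => snd (integrand l1 l2 t)) PI).
2: { intros t; rewrite integrand_conj; reflexivity. }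
2: { intros; apply ex_RInt_integrand. }
apply (is_RInt_fct_extend_pair (U := R_NormedModule) (V := R_NormedModule));
  apply (RInt_correct (V := R_CompleteNormedModule)), ex_RInt_integrand.
Qed.

Lemma E_err_le : 19500 <= N -> d <= 36/1000 -> 702 <= N * d ->
  E_err l1 l2 <= 44/100 * d.
Proof.
intros hN hsmall hNd; pose proof d_pos as hd; pose proof PI_RGT_0 as hpi.
(* Scales the integrand to modulus [1] at the saddle. *)
set (k := 2 * PI / sqrt 2 ^ (l1 + l2)).
set (phi := INR l1 * gamma1 l1 l2 + INR l2 * gamma2 l1 l2).
pose proof Rlt_sqrt2_0 as hs2; assert (hs : 0 < sqrt 2 ^ (l1 + l2)) by now apply pow_lt.
assert (hsad := integrand_at_saddle hsmall); fold phi in hsad.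
assert (hfst : k * fst (integrand l1 l2 th0) = cos phi).
{ rewrite hsad; unfold k, Cexpi, Cmult, RtoC; simpl; field; lra. }
assert (hsnd : k * snd (integrand l1 l2 th0) = sin phi).
{ rewrite hsad; unfold k, Cexpi, Cmult, RtoC; simpl; field; lra. }
pose proof (normalized_integral l2 d (fun t => k * fst (integrand l1 l2 t))
  (fun t => k * snd (integrand l1 l2 t))) as hmain.
fold N e in hmain; fold th0 in hmain; cbv beta in hmain.
rewrite hfst, hsnd in hmain.
assert (hE : E_err l1 l2
  = Rabs (sqrt (N / (2 * PI)) * RInt (fun t => k * fst (integrand l1 l2 t)) 0 PI - cos phi)).
{ unfold E_err; rewrite I_int_eq; fold phi.
  rewrite <- RtoC_mult, <- RtoC_minus, Cmod_R; do 2 f_equal.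
  replace (INR l1 + INR l2 + 1) with (INR (S (l1 + l2))) by (rewrite S_INR, plus_INR; ring).
  rewrite Rpower_half.
  replace (RInt (fun t => k * fst (integrand l1 l2 t)) 0 PI)
    with (k * RInt (fun t => fst (integrand l1 l2 t)) 0 PI).
  2: { symmetry; apply (RInt_scal (V := R_CompleteNormedModule)), ex_RInt_integrand. }
  (* Reconciles the two normalisations; [sqrt 2] is the factor [2] from symmetry divided by the
     extra [sqrt 2] in the exponent [l1 + l2 + 1]. *)
  assert (hq : sqrt (PI * INR l2) * sqrt 2 = sqrt (N / (2 * PI)) * (2 * PI)).
  { rewrite <- (sqrt_pow2 (2 * PI)) at 2 by lra.
    assert (0 <= N / (2 * PI)) by (apply Rdiv_le_0_compat; lra).
    assert (0 <= PI * N) by (apply Rmult_le_pos; lra).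
    fold N; rewrite <- (sqrt_mult (PI * N)), <- (sqrt_mult (N / (2 * PI)))
      by (try apply pow2_ge_0; lra).
    f_equal; field; lra. }
  unfold k; simpl pow.
  replace (sqrt (N / (2 * PI)) * (2 * PI / sqrt 2 ^ (l1 + l2) *
      RInt (fun t => fst (integrand l1 l2 t)) 0 PI))
    with (sqrt (N / (2 * PI)) * (2 * PI) / sqrt 2 ^ (l1 + l2) *
      RInt (fun t => fst (integrand l1 l2 t)) 0 PI) by (field; lra).
  rewrite <- hq.
  replace (2 * RInt (fun t => fst (integrand l1 l2 t)) 0 PI)
    with (sqrt 2 ^ 2 * RInt (fun t => fst (integrand l1 l2 t)) 0 PI)
    by (rewrite pow2_sqrt; lra).
  field; lra. }
rewrite hE; apply hmain; try lra.
- intros t; destruct (integrand_log_derive t) as [h _].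
  replace (_ - _) with (k * fst (integrand l1 l2 t * (p t, q t))%C)
    by (unfold p, q; simpl; ring).
  apply (is_derive_scal (fun t => fst (integrand l1 l2 t))), h.
- intros t; destruct (integrand_log_derive t) as [_ h].
  replace (_ + _) with (k * snd (integrand l1 l2 t * (p t, q t))%C)
    by (unfold p, q; simpl; ring).
  apply (is_derive_scal (fun t => snd (integrand l1 l2 t))), h.
- pose proof (sin2_cos2 phi) as h; unfold Rsqr in h; lra.
Qed.

End Integrand.

(** * Upper bound for pi and the nine estimates *)

(** Otherwise [cos 1.575] would be positive, whereas the double-angle formula with
    [cos 0.7875 <= 0.706 < 1 / sqrt 2] makes it negative. *)
Lemma PI_upper : PI <= 315/100.
Proof.
destruct (Rle_or_lt PI (315/100)) as [h | h]; [assumption|exfalso].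
assert (hc : 0 < cos (1575/1000)) by (apply cos_gt_0; lra).
replace (1575/1000) with (2 * (7875/10000)) in hc by field.
rewrite cos_2a_cos in hc.
assert (0 < cos (7875/10000)) by (apply cos_gt_0; lra).
destruct (cos_bound (7875/10000) 0) as [_ hb]; [lra|lra|].
unfold cos_approx, sum_f_R0, cos_term in hb; simpl in hb.
assert (cos (7875/10000) <= 706/1000) by lra.
nra.
Qed.

Theorem theorem9 (l1 l2 : nat) (hl1 : (0 < l1)%nat) (hl2 : (0 < l2)%nat)
  (hr1 : 1 < INR l1 / INR l2) (hr2 : INR l1 / INR l2 < 3 + 2 * sqrt 2)
  (hd : 702 <= INR l1 - INR l2) :
  (INR l1 - INR l2 <= sqrt (8 * PI * INR l2) -> E_err l1 l2 <= 0.0165) /\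
  (ln (INR l2) <= INR l1 - INR l2 <= sqrt (PI * INR l2) ->
     sqrt (INR l2) * E_err l1 l2 <= 1.05882) /\
  (sqrt (PI * INR l2) <= INR l1 - INR l2 <= sqrt (2 * PI * INR l2) ->
     sqrt (INR l2) * E_err l1 l2 <= 1.30775) /\
  (sqrt (2 * PI * INR l2) <= INR l1 - INR l2 <= sqrt (3 * PI * INR l2) ->
     sqrt (INR l2) * E_err l1 l2 <= 1.50929) /\
  (sqrt (3 * PI * INR l2) <= INR l1 - INR l2 <= sqrt (4 * PI * INR l2) ->
     sqrt (INR l2) * E_err l1 l2 <= 1.68876) /\
  (sqrt (4 * PI * INR l2) <= INR l1 - INR l2 <= sqrt (5 * PI * INR l2) ->
     sqrt (INR l2) * E_err l1 l2 <= 1.85482) /\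
  (sqrt (5 * PI * INR l2) <= INR l1 - INR l2 <= sqrt (6 * PI * INR l2) ->
     sqrt (INR l2) * E_err l1 l2 <= 2.01189) /\
  (sqrt (6 * PI * INR l2) <= INR l1 - INR l2 <= sqrt (7 * PI * INR l2) ->
     sqrt (INR l2) * E_err l1 l2 <= 2.1626) /\
  (sqrt (7 * PI * INR l2) <= INR l1 - INR l2 <= sqrt (8 * PI * INR l2) ->
     sqrt (INR l2) * E_err l1 l2 <= 2.30865).
Proof.
pose proof PI_RGT_0 as hpi0; pose proof PI_upper as hpi1.
assert (hN : 0 < INR l2) by now apply lt_0_INR.
set (N := INR l2) in *; set (D := INR l1 - N) in *.
assert (hkey : forall k, 0 <= k <= 8 -> D <= sqrt (k * PI * N) ->
  E_err l1 l2 <= 44/100 * (D / N) /\ D ^ 2 <= k * PI * N).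
{ intros k hk hD.
  assert (hkN : k * PI * N <= 252/10 * N) by (apply Rmult_le_compat_r; nra).
  assert (h0 : 0 <= k * PI * N) by (apply Rmult_le_pos; [apply Rmult_le_pos|]; lra).
  assert (hD2 : D ^ 2 <= k * PI * N).
  { rewrite <- (pow2_sqrt (k * PI * N)) by assumption; apply pow_incr; lra. }
  (* Combined with [D ^ 2 <= 25.2 * N], this yields [D / N <= 25.2 / 702 < 0.036] and
     [N >= 19500]. *)
  assert (hD3 : 702 * D <= D ^ 2) by nra.
  split; [|assumption].
  assert (hdD : INR l1 / INR l2 - 1 = D / N) by (unfold D; fold N; field; lra).
  rewrite <- hdD; apply E_err_le; rewrite ?hdD; fold N.
  - assumption.
  - unfold D in hd; lra.
  - lra.
  - apply Rle_div_l; lra.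
  - replace (N * (D / N)) with D by (field; lra); assumption. }
(* The constant [61/100] is an upper bound for [(44/100) ^ 2 * PI]. *)
assert (hbound : forall k c, 0 <= k <= 8 -> 0 <= c -> 61 / 100 * k <= c ^ 2 ->
  D <= sqrt (k * PI * N) -> sqrt N * E_err l1 l2 <= c).
{ intros k c hk hc hkc hD; destruct (hkey k hk hD) as [hE hD2].
  assert (hs : 0 < sqrt N) by now apply sqrt_lt_R0.
  apply Rle_trans with (44/100 * (D / sqrt N)).
  - replace (44/100 * (D / sqrt N)) with (sqrt N * (44/100 * (D / sqrt N ^ 2)))
      by (field; lra).
    rewrite pow2_sqrt by lra; apply Rmult_le_compat_l; lra.
  - assert (hq : (D / sqrt N) ^ 2 <= k * PI).
    { replace ((D / sqrt N) ^ 2) with (D ^ 2 / sqrt N ^ 2) by (field; lra).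
      rewrite pow2_sqrt by lra; apply Rle_div_l; lra. }
    assert (0 <= D / sqrt N) by (apply Rdiv_le_0_compat; lra).
    nra. }
repeat split.
- intros hD; destruct (hkey 8 ltac:(lra) hD) as [hE hD2].
  assert (702 * D <= D ^ 2) by nra.
  assert (8 * PI * N <= 252/10 * N) by (apply Rmult_le_compat_r; lra).
  (* [25.2 / 702 < 0.0359], and [0.44 * 0.0359 < 0.0165]. *)
  assert (D / N <= 359/10000) by (apply Rle_div_l; lra).
  lra.
- intros [_ hD]; apply (hbound 1); [lra|lra|lra|now rewrite Rmult_1_l].
- intros [_ hD]; apply (hbound 2); [lra|lra|lra|assumption].
- intros [_ hD]; apply (hbound 3); [lra|lra|lra|assumption].
- intros [_ hD]; apply (hbound 4); [lra|lra|lra|assumption].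
- intros [_ hD]; apply (hbound 5); [lra|lra|lra|assumption].
- intros [_ hD]; apply (hbound 6); [lra|lra|lra|assumption].
- intros [_ hD]; apply (hbound 7); [lra|lra|lra|assumption].
- intros [_ hD]; apply (hbound 8); [lra|lra|lra|assumption].
Qed.
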